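(* Let $A$ be a $\Delta^0_2$ set of nonnegative integers. Then there is a computable coloring $c:\mathbb{N}\to\{0,1\}$ such that, for every infinite set $W\subseteq\mathbb{N}$ for which $\mathrm{FS}^{\leq 2}(W)$ is monochromatic for $c$, there is an infinite set $Y\leq_T W$ such that $Y\subseteq A$ or $Y\subseteq\overline{A}$.
   Context: $\mathbb{N}$ denotes the set of positive integers. For a finite nonempty $F\subseteq\mathbb{N}$, $\sum F$ denotes the sum of the elements of $F$. For $X\subseteq\mathbb{N}$ and $n\geq 1$, $\mathrm{FS}^{\leq n}(X)=\{\sum F \mid F\subseteq X \text{ and } 1\leq |F|\leq n\}$. A set $Z\subseteq\mathbb{N}$ is monochromatic for a coloring $c$ if $c(x)=c(y)$ for all $x,y\in Z$. $\leq_T$ is Turing reducibility, and $\overline{A}$ is the complement of $A$ in the nonnegative integers. *)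

(* Defs.v *)
From mathcomp Require Import all_boot.
From mathcomp Require Import finmap.
From mathcomp Require Import boolp classical_sets cardinality.

Set Implicit Arguments.
Unset Strict Implicit.
Unset Printing Implicit Defensive.

Local Open Scope classical_set_scope.
Local Open Scope nat_scope.

(** Kleene's partial mu-recursive programs of arity [n], with an oracle. *)
Inductive prog : nat -> Type :=
| PZero n : prog n
| PSucc : prog 1
| PProj n (i : 'I_n) : prog n
| POracle : prog 1
| PComp k n (f : prog k) (g : 'I_k -> prog n) : prog n
| PRec n (f : prog n) (g : prog n.+2) : prog n.+1
| PMin n (f : prog n.+1) : prog n.

(** [eval O p v y]: with oracle [O], the program [p] halts on input [v] with
    output [y].  For [PRec], [s] lists the successive values of the recursion
    on the first argument; for [PMin], every value tested before [y] has to be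
    defined and nonzero. *)
Fixpoint eval (O : nat -> nat) (n : nat) (p : prog n) :
    n.-tuple nat -> nat -> Prop :=
  match p in prog n return n.-tuple nat -> nat -> Prop with
  | PZero _ => fun _ y => y = 0
  | PSucc => fun v y => y = (thead v).+1
  | PProj _ i => fun v y => y = tnth v i
  | POracle => fun v y => y = O (thead v)
  | PComp k _ f g => fun v y =>
      exists2 w : k.-tuple nat,
        forall i, eval O (g i) v (tnth w i) & eval O f w y
  | PRec _ f g => fun v y =>
      exists s : nat -> nat,
        [/\ eval O f [tuple of behead v] (s 0),
            forall i, i < thead v ->
              eval O g [tuple of i :: s i :: behead v] (s i.+1)
          & y = s (thead v)]
  | PMin _ f => fun v y =>
      eval O f [tuple of y :: v] 0 /\
      forall z, z < y -> exists k, eval O f [tuple of z :: v] k.+1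
  end.

Definition computable_in (O : nat -> nat) (n : nat) (f : n.-tuple nat -> nat) :=
  exists p : prog n, forall v, eval O p v (f v).

(** The constant oracle gives no information: it is itself computable. *)
Definition computable (n : nat) (f : n.-tuple nat -> nat) :=
  computable_in (fun=> 0) f.

Definition char_fun (T : Type) (X : set T) (x : T) : nat := x \in X.

Definition computable_rel (n : nat) (R : set (n.-tuple nat)) :=
  computable (char_fun R).

Definition turing_le (Y W : set nat) :=
  computable_in (char_fun W) (fun v : 1.-tuple nat => char_fun Y (thead v)).

Definition Sigma02 (A : set nat) :=
  exists2 R : set (3.-tuple nat), computable_rel R &
    forall x, A x <-> exists y, forall z, R [tuple x; y; z].

Definition Pi02 (A : set nat) :=
  exists2 R : set (3.-tuple nat), computable_rel R &
    forall x, A x <-> forall y, exists z, R [tuple x; y; z].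

Definition Delta02 (A : set nat) := Sigma02 A /\ Pi02 A.

(** The sums of at least one and at most [n] distinct elements of [X]. *)
Definition FS_le (n : nat) (X : set nat) : set nat :=
  [set x | exists F : {fset nat},
     [/\ [set` F] `<=` X, 1 <= #|` F| <= n & x = \sum_(i <- F) i]].

Definition posnat : set nat := [set x | 0 < x].

Definition monochromatic (C : Type) (c : nat -> C) (Z : set nat) :=
  forall x y, Z x -> Z y -> c x = c y.

(* Main.v *)
(** Let [f x s] be a computable approximation converging to [A x], let [val3 n]
    be the position of the lowest nonzero ternary digit of [n], and color [n] by
    [f (val3 n) n] plus, modulo 2, the truth value of "this digit is 1".  Adding
    two numbers with the same lowest digit at the same position keeps the
    position but flips the digit between 1 and 2, so a monochromatic [W] cannot
    have infinitely many elements sharing position and digit; hence [val3] is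
    unbounded on [W].  Adding to [x] an element of [W] with a large [val3]
    changes neither position nor digit but lets the approximation converge, so
    the common color determines [A (val3 x)] from the digit of [x].  Infinitely
    many positions come with the same digit, and a thinned [W]-computable set of
    these lies in [A] or in its complement. *)
Require Import Defs.
From mathcomp Require Import all_boot.
From mathcomp Require Import finmap zify.
From mathcomp Require Import boolp classical_sets cardinality.

Set Implicit Arguments.
Unset Strict Implicit.
Unset Printing Implicit Defensive.

Local Open Scope classical_set_scope.
Local Open Scope nat_scope.

(** * Closure properties of oracle computability *)

Lemma computable_in_comp O k n (f : k.-tuple nat -> nat)
    (gs : k.-tuple (n.-tuple nat -> nat)) :
  computable_in O f -> (forall i, computable_in O (tnth gs i)) ->
  computable_in O (fun v => f (map_tuple (fun g => g v) gs)).
Proof.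
move=> [p fp] /choice[q gq]; exists (PComp p q) => v /=.
by exists (map_tuple (fun g => g v) gs) => // i; rewrite tnth_map.
Qed.

Lemma computable_in_comp1 O n (F : nat -> nat) (g : n.-tuple nat -> nat) :
  computable_in O (fun v : 1.-tuple nat => F (nth 0 v 0)) ->
  computable_in O g -> computable_in O (fun v => F (g v)).
Proof.
move=> cF cg; apply: (computable_in_comp (gs := [tuple g]) cF) => i.
by rewrite ord1.
Qed.

Lemma computable_in_comp2 O n (F : nat -> nat -> nat)
    (g h : n.-tuple nat -> nat) :
  computable_in O (fun v : 2.-tuple nat => F (nth 0 v 0) (nth 0 v 1)) ->
  computable_in O g -> computable_in O h ->
  computable_in O (fun v => F (g v) (h v)).
Proof.
move=> cF cg ch; apply: (computable_in_comp (gs := [tuple g; h]) cF).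
by case=> [[|[|]] lti] //; rewrite (tnth_nth g).
Qed.

Lemma computable_in_comp3 O n (F : nat -> nat -> nat -> nat)
    (g h k : n.-tuple nat -> nat) :
  computable_in O
    (fun v : 3.-tuple nat => F (nth 0 v 0) (nth 0 v 1) (nth 0 v 2)) ->
  computable_in O g -> computable_in O h -> computable_in O k ->
  computable_in O (fun v => F (g v) (h v) (k v)).
Proof.
move=> cF cg ch ck; apply: (computable_in_comp (gs := [tuple g; h; k]) cF).
by case=> [[|[|[|]]] lti] //; rewrite (tnth_nth g).
Qed.

Lemma computable_in_nth O n k :
  computable_in O (fun v : n.-tuple nat => nth 0 v k).
Proof.
have [ltkn|lenk] := ltnP k n.
  exists (PProj (Ordinal ltkn)) => v /=.
  by rewrite (tnth_nth 0).
by exists (PZero n) => v /=; rewrite nth_default ?size_tuple.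
Qed.

Lemma computable_in_behead O n (f : n.-tuple nat -> nat) :
  computable_in O f ->
  computable_in O (fun v : n.+1.-tuple nat => f (behead_tuple v)).
Proof.
move=> [p fp]; exists (PComp p (fun i => PProj (lift ord0 i))) => v /=.
by exists (behead_tuple v) => // i; rewrite !(tnth_nth 0) nth_behead.
Qed.

Lemma theadE n (v : n.+1.-tuple nat) : thead v = nth 0 v 0.
Proof. exact: tnth_nth. Qed.

Lemma computable_in_oracle O n (f : n.-tuple nat -> nat) :
  computable_in O f -> computable_in O (fun v => O (f v)).
Proof. by apply: computable_in_comp1; exists POracle => v /=; rewrite theadE. Qed.

Lemma computable_inS O n (f : n.-tuple nat -> nat) :
  computable_in O f -> computable_in O (fun v => (f v).+1).
Proof. by apply: (@computable_in_comp1 _ _ succn); exists PSucc => v /=; rewrite theadE. Qed.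

Lemma computable_in_cst O n k : computable_in O (fun _ : n.-tuple nat => k).
Proof.
by elim: k => [|k /computable_inS//]; exists (PZero n).
Qed.

Lemma computable_in_rec O n (f : n.-tuple nat -> nat)
    (g : n.+2.-tuple nat -> nat) (h : n.+1.-tuple nat -> nat) :
  computable_in O f -> computable_in O g ->
  (forall v, h (cons_tuple 0 v) = f v) ->
  (forall i v, h (cons_tuple i.+1 v) =
     g (cons_tuple i (cons_tuple (h (cons_tuple i v)) v))) ->
  computable_in O h.
Proof.
move=> [p fp] [q gq] h0 hS; exists (PRec p q) => v /=.
exists (fun i => h (cons_tuple i (behead_tuple v))); split => [|i _|].
- by rewrite h0; apply: fp.
- by rewrite hS; apply: gq.
- by congr h; rewrite [LHS]tuple_eta; apply: val_inj.
Qed.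

(** [PMin] searches for a zero, whence the negation in the hypothesis: as a number, [~~ h w] is 0
    exactly where [h w] holds, and 1, a successor, elsewhere. *)
Lemma computable_in_min O n (h : n.+1.-tuple nat -> bool)
    (H : forall v, exists y, h (cons_tuple y v)) :
  computable_in O (fun w => ~~ h w) ->
  computable_in O (fun v => ex_minn (H v)).
Proof.
move=> [p hp]; exists (PMin p) => v /=.
case: ex_minnP => m hm minm; split.
  by have := hp (cons_tuple m v); rewrite hm.
move=> z ltzm; exists 0; have := hp (cons_tuple z v).
by case: (boolP (h _)) => // /minm; rewrite leqNgt ltzm.
Qed.

Lemma computable_in_add O n (f g : n.-tuple nat -> nat) :
  computable_in O f -> computable_in O g ->
  computable_in O (fun v => f v + g v).
Proof.
apply: computable_in_comp2.
apply: (computable_in_rec (computable_in_nth O 1 0)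
  (computable_inS (computable_in_nth O 3 1))) => //.
Qed.

Lemma computable_in_mul O n (f g : n.-tuple nat -> nat) :
  computable_in O f -> computable_in O g ->
  computable_in O (fun v => f v * g v).
Proof.
apply: computable_in_comp2.
apply: (computable_in_rec (computable_in_cst O 1 0)
  (computable_in_add (computable_in_nth O 3 2) (computable_in_nth O 3 1))) => //.
Qed.

Lemma computable_in_exp O n k (f : n.-tuple nat -> nat) :
  computable_in O f -> computable_in O (fun v => k ^ f v).
Proof.
apply: computable_in_comp1.
apply: (computable_in_rec (computable_in_cst O 0 1)
  (computable_in_mul (computable_in_cst O 2 k) (computable_in_nth O 2 1))) => // i v.
by rewrite /= expnS.
Qed.

Lemma computable_in_pred O n (f : n.-tuple nat -> nat) :
  computable_in O f -> computable_in O (fun v => (f v).-1).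
Proof.
apply: computable_in_comp1.
(* Entry 0 of the input to the recursion step is the index [i], the predecessor of [i.+1]. *)
by apply: (computable_in_rec (computable_in_cst O 0 0) (computable_in_nth O 2 0)).
Qed.

Lemma computable_in_sub O n (f g : n.-tuple nat -> nat) :
  computable_in O f -> computable_in O g ->
  computable_in O (fun v => f v - g v).
Proof.
(* [PRec] recurses on its first argument, whereas subtraction recurses on the subtrahend; the
   arguments are therefore swapped. *)
move=> cf cg; move: cg cf; apply: (@computable_in_comp2 _ _ (fun a b => b - a)).
apply: (computable_in_rec (computable_in_nth O 1 0)
  (computable_in_pred (computable_in_nth O 3 1))) => [v|i v] /=.
  by rewrite subn0.
by rewrite subnS.
Qed.

Lemma computable_in_neg O n (b : n.-tuple nat -> bool) :
  computable_in O (fun v => b v) -> computable_in O (fun v => ~~ b v).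
Proof.
move=> /(computable_in_sub (computable_in_cst O n 1)).
by congr computable_in; apply: funext => v; case: (b v).
Qed.

Lemma computable_in_leq O n (f g : n.-tuple nat -> nat) :
  computable_in O f -> computable_in O g ->
  computable_in O (fun v => f v <= g v).
Proof.
move=> cf cg.
(* Subtraction is truncated, so [1 - (f v - g v)] is 1 exactly when [f v <= g v]. *)
have /(computable_in_sub (computable_in_cst O n 1)) := computable_in_sub cf cg.
congr computable_in; apply: funext => v; rewrite -subn_eq0.
by case: (f v - g v).
Qed.

Lemma computable_in_and O n (b c : n.-tuple nat -> bool) :
  computable_in O (fun v => b v) -> computable_in O (fun v => c v) ->
  computable_in O (fun v => b v && c v).
Proof.
move=> cb /(computable_in_mul cb); congr computable_in; apply: funext => v.
by rewrite mulnb.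
Qed.

Lemma computable_in_or O n (b c : n.-tuple nat -> bool) :
  computable_in O (fun v => b v) -> computable_in O (fun v => c v) ->
  computable_in O (fun v => b v || c v).
Proof.
move=> /computable_in_neg cb /computable_in_neg /(computable_in_and cb).
move=> /computable_in_neg; congr computable_in; apply: funext => v.
by rewrite negb_and !negbK.
Qed.

Lemma computable_in_eq O n (f g : n.-tuple nat -> nat) :
  computable_in O f -> computable_in O g ->
  computable_in O (fun v => f v == g v).
Proof.
move=> cf cg; under eq_fun do rewrite eqn_leq.
by apply: computable_in_and; apply: computable_in_leq.
Qed.

Lemma computable_in_addb O n (b c : n.-tuple nat -> bool) :
  computable_in O (fun v => b v) -> computable_in O (fun v => c v) ->
  computable_in O (fun v => b v (+) c v).
Proof.
move=> cb /(computable_in_eq cb) /computable_in_neg; congr computable_in.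
by apply: funext => v; case: (b v); case: (c v).
Qed.

(** Unbounded search for the least counterexample, forced to stop at [b v]; the universal statement
    holds exactly when the search gets as far as [b v]. *)
Lemma computable_in_forall O n (h : n.+1.-tuple nat -> bool)
    (b : n.-tuple nat -> nat) :
  computable_in O (fun w => h w) -> computable_in O b ->
  computable_in O (fun v => [forall z : 'I_(b v), h (cons_tuple (z : nat) v)]).
Proof.
move=> ch cb.
pose k (w : n.+1.-tuple nat) := (b (behead_tuple w) <= nth 0 w 0) || ~~ h w.
have bK y v : b (behead_tuple (cons_tuple y v)) = b v.
  by congr b; apply: val_inj.
have kP v : exists y, k (cons_tuple y v).
  by exists (b v); rewrite /k bK leqnn.
have cm : computable_in O (fun v => ex_minn (kP v)).
  apply/computable_in_min/computable_in_neg/computable_in_or.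
    exact/computable_in_leq/computable_in_nth/computable_in_behead.
  exact: computable_in_neg.
have := computable_in_leq cb cm; congr computable_in; apply: funext => v.
congr nat_of_bool; case: ex_minnP => m; rewrite /k bK /= => km minm.
apply/idP/forallP => [lebm z|hv].
  apply: contraT => hz; have := minm z; rewrite bK /= hz orbT => /(_ isT).
  by move: (ltn_ord z); lia.
rewrite leqNgt; apply/negP => ltmb; have := hv (Ordinal ltmb).
by move: km; rewrite leqNgt ltmb /= => /negPf ->.
Qed.

(** A search finds the least [q] with [m <= q * p ^ k], the quotient rounded up; divisibility means
    that equality holds for this [q]. *)
Lemma computable_in_dvdn_exp O n p (k m : n.-tuple nat -> nat) : 0 < p ->
  computable_in O k -> computable_in O m ->
  computable_in O (fun v => p ^ k v %| m v).
Proof.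
move=> p0; apply: (@computable_in_comp2 _ _ (fun a b => p ^ a %| b)).
set pow := fun v : 2.-tuple nat => p ^ nth 0 v 0.
have q0 v : 0 < pow v by rewrite expn_gt0 p0.
pose h (w : 3.-tuple nat) := nth 0 w 2 <= nth 0 w 0 * p ^ nth 0 w 1.
have hP v : exists y, h (cons_tuple y v).
  by exists (nth 0 v 1); rewrite /h /= leq_pmulr ?q0.
have cm : computable_in O (fun v => ex_minn (hP v)).
  apply/computable_in_min/computable_in_neg/computable_in_leq.
    exact: computable_in_nth.
  apply/computable_in_mul/computable_in_exp; exact: computable_in_nth.
have cpow : computable_in O pow.
  exact/computable_in_exp/computable_in_nth.
have := computable_in_eq (computable_in_mul cm cpow) (computable_in_nth O 2 1).
congr computable_in; apply: funext => v; congr nat_of_bool.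
case: ex_minnP => q; rewrite /h /= -!/(pow v) => hq minq.
apply/eqP/dvdnP => [<-|[r er]]; first by exists q.
apply/eqP; rewrite eqn_leq hq andbT er leq_mul2r minq ?orbT //=.
by rewrite er.
Qed.

(** With the tuple rebuilt from its entries, [computable_in_comp3] can substitute and permute the
    arguments of [R]. *)
Lemma computable_in_char3 O (R : set (3.-tuple nat)) :
  computable_in O (char_fun R) ->
  computable_in O (fun v : 3.-tuple nat =>
    [tuple nth 0 v 0; nth 0 v 1; nth 0 v 2] \in R).
Proof.
congr computable_in; apply: funext => v; rewrite /char_fun.
by congr (nat_of_bool (_ \in R)); apply: val_inj; case/tupleP: v => a v;
  case/tupleP: v => b v; case/tupleP: v => c v; rewrite (tuple0 v).
Qed.

(** * Computable approximation of a Delta^0_2 set *)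

Lemma forall_ord_eventually (P : pred nat) :
  exists N, forall s, N <= s -> [forall z : 'I_s, P z] = `[<forall z, P z>].
Proof.
have [allP|/existsNP[z /negP Pz]] := pselect (forall z, P z).
  exists 0 => s _; rewrite asboolT //; exact/forallP.
exists z.+1 => s ltzs; rewrite asboolF => [|/(_ z)]; last exact/negP.
by apply/negbTE/forallPn; exists (Ordinal ltzs).
Qed.

(* Witnesses for membership and for non-membership are searched
   simultaneously: at stage [s] one takes the least [y] not yet refuted. *)
Lemma Delta02_limit A : Delta02 A -> exists2 f : nat -> nat -> bool,
  computable (fun v : 2.-tuple nat => f (nth 0 v 0) (nth 0 v 1)) &
  forall x, exists N, forall s, N <= s -> f x s = `[<A x>].
Proof.
move=> [[R cR RP] [S cS SP]].
(* At stage [s], [r] says that [y] is not yet refuted as a witness of membership. [t] does so for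
   non-membership, since negating the Pi^0_2 form given by [S] yields a Sigma^0_2 form of the
   complement. *)
pose r x y s := [forall z : 'I_s, [tuple x; y; z : nat] \in R].
pose t x y s := [forall z : 'I_s, [tuple x; y; z : nat] \notin S].
(* The entries of [w] are the candidate [y], then [x], then [s]. The cutoff [s <= y] makes the
   search total. *)
pose h (w : 3.-tuple nat) := [|| nth 0 w 2 <= nth 0 w 0,
  r (nth 0 w 1) (nth 0 w 0) (nth 0 w 2) | t (nth 0 w 1) (nth 0 w 0) (nth 0 w 2)].
have hP v : exists y, h (cons_tuple y v).
  by exists (nth 0 v 1); rewrite /h /= leqnn.
pose m x s := ex_minn (hP [tuple x; s]).
have cr n (f g k : n.-tuple nat -> nat) : computable f -> computable g ->
    computable k -> computable (fun v => r (f v) (g v) (k v)).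
  apply: (@computable_in_comp3 _ _ (fun a b c => r a b c)).
  apply: (computable_in_forall (h := fun w =>
    [tuple nth 0 w 1; nth 0 w 2; nth 0 w 0] \in R)); last exact: computable_in_nth.
  apply: (computable_in_comp3 (F := fun a b c => [tuple a; b; c] \in R)
    (computable_in_char3 cR));
    exact: computable_in_nth.
have ct n (f g k : n.-tuple nat -> nat) : computable f -> computable g ->
    computable k -> computable (fun v => t (f v) (g v) (k v)).
  apply: (@computable_in_comp3 _ _ (fun a b c => t a b c)).
  apply: (computable_in_forall (h := fun w =>
    [tuple nth 0 w 1; nth 0 w 2; nth 0 w 0] \notin S)); last exact: computable_in_nth.
  apply: computable_in_neg.
  apply: (computable_in_comp3 (F := fun a b c => [tuple a; b; c] \in S)
    (computable_in_char3 cS));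
    exact: computable_in_nth.
have cm : computable (fun v : 2.-tuple nat => m (nth 0 v 0) (nth 0 v 1)).
  have : computable (fun v => ex_minn (hP v)).
    apply/computable_in_min/computable_in_neg/computable_in_or.
      apply: computable_in_leq; exact: computable_in_nth.
    apply: computable_in_or; [apply: cr|apply: ct]; exact: computable_in_nth.
  by congr computable_in; apply: funext => v; apply: eq_ex_minn.
exists (fun x s => r x (m x s) s).
  by apply: cr => //; apply: computable_in_nth.
move=> x.
pose rr y := `[<forall z, [tuple x; y; z] \in R>].
pose tt y := `[<forall z, [tuple x; y; z] \notin S>].
have rrA y : rr y -> A x.
  by move=> /asboolP ry; apply/RP; exists y => z; have := ry z; rewrite inE.
have ttA y : tt y -> ~ A x.
  move=> /asboolP ty /SP /(_ y)[z Sz].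
  by have /negP := ty z; apply; apply: mem_set.
have ex_rt : exists y, rr y || tt y.
  have [/RP[y ry]|nA] := pselect (A x).
    by exists y; apply/orP; left; apply/asboolP => z; rewrite inE.
  have [y ty] : exists y, forall z, ~ S [tuple x; y; z].
    apply: contrapT => /forallNP nS; apply: nA; apply/SP => y.
    by have /existsNP[z /contrapT Sz] := nS y; exists z.
  exists y; apply/orP; right; apply/asboolP => z.
  by apply/negP; rewrite inE.
case: (ex_minnP ex_rt) => y0 rty0 miny0.
have stable y : exists N, forall s, N <= s ->
    r x y s = rr y /\ t x y s = tt y.
  have [N1 hN1] := forall_ord_eventually (fun z => [tuple x; y; z] \in R).
  have [N2 hN2] := forall_ord_eventually (fun z => [tuple x; y; z] \notin S).
  exists (maxn N1 N2) => s; rewrite geq_max => /andP[le1 le2].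
  by split; [apply: hN1|apply: hN2].
have [N hN] := boolp.choice stable.
(* Beyond [y0] the cutoff cannot stop the search at a candidate up to [y0]; beyond these [N y], all
   such candidates have reached their final status. *)
exists (maxn y0.+1 (\max_(y < y0.+1) N y)) => s.
rewrite geq_max => /andP[lty0 leN].
have rts y : y <= y0 -> r x y s = rr y /\ t x y s = tt y.
  move=> ley; apply: hN; apply: leq_trans leN.
  exact: (@leq_bigmax _ (fun y : 'I_y0.+1 => N y) (Ordinal (ley : y < y0.+1))).
have -> : m x s = y0.
  rewrite /m; case: ex_minnP => y; rewrite /h /= => hy miny.
  have ley : y <= y0.
    by apply: miny; have [-> ->] := rts _ (leqnn y0); rewrite rty0 orbT.
  apply/eqP; rewrite eqn_leq ley /=; apply: miny0.
  by have [<- <-] := rts _ ley; move: hy; rewrite leqNgt (leq_ltn_trans ley).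
have [-> _] := rts _ (leqnn y0); move: rty0; case: (boolP (rr y0)) => /= [ry _|_ ty].
  by rewrite asboolT //; apply: rrA ry.
by rewrite asboolF //; apply: ttA ty.
Qed.

(** * The lowest nonzero ternary digit and its position *)

Definition val3 x := logn 3 x.
(* The lowest nonzero ternary digit [m %% 3] of [x = 3 ^ a * m] is [1] iff
   [3] divides [m + 2], i.e. iff [3 ^ a.+1] divides [x + 2 * 3 ^ a]. *)
Definition digit1 x := 3 ^ (val3 x).+1 %| x + 2 * 3 ^ val3 x.

Lemma val3_decomp x : 0 < x -> exists2 m, ~~ (3 %| m) & x = 3 ^ val3 x * m.
Proof.
move=> x0; have [m cm xE] := pfactor_coprime (isT : prime 3) x0.
by exists m; rewrite -?prime_coprime // mulnC.
Qed.

Lemma val3_expM a m : ~~ (3 %| m) ->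
  val3 (3 ^ a * m) = a /\ digit1 (3 ^ a * m) = (m %% 3 == 1).
Proof.
move=> m3; have m0 : 0 < m by case: m m3.
have va : val3 (3 ^ a * m) = a.
  rewrite /val3 lognM ?expn_gt0 // pfactorK //.
  by rewrite (@lognE 3 m) (negPf m3) !andbF addn0.
split=> //; rewrite /digit1 va expnSr [2 * _]mulnC -mulnDr.
by rewrite dvdn_pmul2l ?expn_gt0 //; lia.
Qed.

Lemma val3_add_lt x y : 0 < x -> 0 < y -> val3 x < val3 y ->
  val3 (x + y) = val3 x /\ digit1 (x + y) = digit1 x.
Proof.
move=> /val3_decomp[m m3 xE] /val3_decomp[k k3 yE] ltxy.
(* The summand [y] is a multiple of [3 ^ (val3 x).+1], so it alters the cofactor [m] of [x] only by
   a multiple of 3. *)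
have [k' k'E] : exists k', y = 3 ^ val3 x * (3 * k').
  exists (3 ^ (val3 y - (val3 x).+1) * k).
  by rewrite mulnA -expnSr mulnA -expnD subnKC.
have [] := @val3_expM (val3 x) (m + 3 * k'); first by lia.
have [_] := val3_expM (val3 x) m3.
by rewrite -xE mulnDr -xE -k'E => -> -> ->; split=> //; lia.
Qed.

Lemma val3_add_eq x y : 0 < x -> 0 < y -> val3 x = val3 y ->
  digit1 x = digit1 y ->
  val3 (x + y) = val3 x /\ digit1 (x + y) = ~~ digit1 x.
Proof.
move=> /val3_decomp[m m3 xE] /val3_decomp[k k3 yE] vxy dxy.
rewrite -vxy in yE; have [_ dx] := val3_expM (val3 x) m3.
have [_ dy] := val3_expM (val3 x) k3.
rewrite -xE in dx; rewrite -yE in dy.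
(* Modulo 3 the cofactors agree and are nonzero, so [m + k] is congruent to [2 * m]: still nonzero,
   with 1 and 2 exchanged. *)
have [] := @val3_expM (val3 x) (m + k); first by lia.
by rewrite mulnDr -xE -yE dx => -> ->; split=> //; lia.
Qed.

(** Since [3 ^ val3 x] divides [x], a large [val3] forces a large number, that is, a late stage of
    the approximation in [mono_color]. *)
Lemma val3_lt x : 0 < x -> val3 x < x.
Proof.
by move=> x0; apply: leq_trans (dvdn_leq x0 (pfactor_dvdnn 3 x)); apply: ltn_expl.
Qed.

Lemma computable_in_val3 O n (f : n.-tuple nat -> nat) :
  computable_in O f -> computable_in O (fun v => val3 (f v)).
Proof.
apply: computable_in_comp1.
(* Every power of 3 divides 0; the first disjunct stops the search there at once, in agreement with
   [logn 3 0 = 0]. *)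
pose h (w : 2.-tuple nat) := (nth 0 w 1 <= 0) || ~~ (3 ^ (nth 0 w 0).+1 %| nth 0 w 1).
have hE y (v : 1.-tuple nat) : 0 < nth 0 v 0 ->
    h (cons_tuple y v) = (val3 (nth 0 v 0) <= y).
  by move=> v0; rewrite /h /= leqNgt v0 pfactor_dvdn // -leqNgt.
have hP v : exists y, h (cons_tuple y v).
  have [v0|v0] := posnP (nth 0 v 0); first by exists 0; rewrite /h /= v0.
  by exists (val3 (nth 0 v 0)); rewrite hE.
suff : computable_in O (fun v => ex_minn (hP v)).
  congr computable_in; apply: funext => v; case: ex_minnP => m.
  have [v0 _ /(_ 0)|v0] := posnP (nth 0 v 0).
    by rewrite /h /= v0 => /(_ isT); rewrite leqn0 => /eqP ->.
  rewrite hE // => lem /(_ (val3 (nth 0 v 0))); rewrite hE // leqnn => /(_ isT).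
  by move=> ge; apply/eqP; rewrite eqn_leq lem ge.
apply/computable_in_min/computable_in_neg/computable_in_or.
  by apply: computable_in_leq; [apply: computable_in_nth|apply: computable_in_cst].
apply/computable_in_neg/computable_in_dvdn_exp => //; last exact: computable_in_nth.
exact/computable_inS/computable_in_nth.
Qed.

Lemma computable_in_digit1 O n (f : n.-tuple nat -> nat) :
  computable_in O f -> computable_in O (fun v => digit1 (f v)).
Proof.
move=> cf; apply: computable_in_dvdn_exp => //.
  exact/computable_inS/computable_in_val3.
apply: computable_in_add => //; apply: computable_in_mul.
  exact: computable_in_cst.
exact/computable_in_exp/computable_in_val3.
Qed.

(** * Colors of sums from a monochromatic set *)

Lemma infinite_nat_unbounded (W : set nat) :
  infinite_set W <-> forall n, exists2 x, W x & n <= x.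
Proof.
split=> [infW n|unbW finW].
  apply: contrapT => bW; apply: infW; apply: sub_finite_set (finite_II n) => x Wx /=.
  by rewrite ltnNge; apply/negP => le; apply: bW; exists x.
have /finite_fsetP[X WE] := finW.
have [x] := unbW (\max_(x <- X) x).+1; rewrite WE /= => Xx.
by rewrite ltnNge leq_bigmax_seq.
Qed.

Lemma FS_le2_self (W : set nat) x : W x -> FS_le 2 W x.
Proof.
move=> Wx; exists [fset x]%fset; rewrite cardfs1 big_seq_fset1; split=> //.
by move=> y /=; rewrite inE => /eqP ->.
Qed.

Lemma FS_le2_add (W : set nat) x y : W x -> W y -> x != y -> FS_le 2 W (x + y).
Proof.
move=> Wx Wy xy; exists [fset x; y]%fset; rewrite cardfs2 xy; split=> //.
  by move=> z /=; rewrite !inE => /orP[] /eqP ->.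
by rewrite big_fsetU1 ?inE //= big_seq_fset1.
Qed.

Definition coloring (f : nat -> nat -> bool) n := f (val3 n) n (+) digit1 n.

Lemma mono_val3_unbounded (A : set nat) (f : nat -> nat -> bool) (W : set nat) :
  (forall x, exists N, forall s, N <= s -> f x s = `[<A x>]) ->
  W `<=` posnat -> infinite_set W ->
  monochromatic (coloring f) (FS_le 2 W) ->
  forall n, exists2 x, W x & n <= val3 x.
Proof.
move=> limf Wpos Winf monoW n; apply: contrapT => bW; apply: Winf.
(* If [val3] is below [n] on [W], finitely many pairs of position and digit cover [W], so it
   suffices that each fiber is finite. *)
pose fiber p := [set x | [/\ W x, val3 x = p.1 & digit1 x = p.2]].
apply: (@sub_finite_set _ _ (\bigcup_(p in `I_n `*` [set: bool]) fiber p)).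
  move=> x Wx; exists (val3 x, digit1 x) => //; split=> //=.
  by rewrite ltnNge; apply/negP => lex; apply: bW; exists x.
apply: bigcup_finite => [|[a b] _]; first exact: finite_setX.
apply: contrapT => /infinite_nat_unbounded unb.
have [N hN] := limf a.
(* Two distinct elements of the fiber, both at least [N]: the approximation has settled at [x] and
   at [x + y], and only the digit term of the color changes. *)
have [x [Wx /= vx dx] leNx] := unb N.
have [y [Wy /= vy dy] ltxy] := unb x.+1.
have [] := @val3_add_eq x y (Wpos _ Wx) (Wpos _ Wy); rewrite ?vy ?dy // => vxy dxy.
have xy : x != y by rewrite ltn_eqF.
have := monoW _ _ (FS_le2_self Wx) (FS_le2_add Wx Wy xy).
rewrite /coloring vxy dxy vx !hN //; last by lia.
by case: (`[<_>]); case: digit1.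
Qed.

Lemma mono_color (A : set nat) (f : nat -> nat -> bool) (W : set nat) x :
  (forall x, exists N, forall s, N <= s -> f x s = `[<A x>]) ->
  W `<=` posnat -> infinite_set W ->
  monochromatic (coloring f) (FS_le 2 W) -> W x ->
  coloring f x = `[<A (val3 x)>] (+) digit1 x.
Proof.
move=> limf Wpos Winf monoW Wx.
have [N hN] := limf (val3 x).
(* The approximation need not have settled at stage [x]. The bound [(val3 x).+1] preserves position
   and digit in [x + y], and [N] makes [x + y] a late enough stage. *)
have [y Wy] := mono_val3_unbounded limf Wpos Winf monoW (maxn N (val3 x).+1).
rewrite geq_max => /andP[leNy ltxy].
have xy : x != y by apply: contraTneq ltxy => ->; rewrite ltnn.
have [vxy dxy] := val3_add_lt (Wpos _ Wx) (Wpos _ Wy) ltxy.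
rewrite (monoW _ _ (FS_le2_self Wx) (FS_le2_add Wx Wy xy)) /coloring vxy dxy hN //.
by have := val3_lt (Wpos _ Wy); lia.
Qed.

Lemma mono_digit (W : set nat) :
  (forall n, exists2 x, W x & n <= val3 x) ->
  exists b, forall n, exists x, [/\ W x, digit1 x = b & n <= val3 x].
Proof.
move=> unb; apply: contrapT => /forallNP nob.
have /existsNP[n1 h1] := nob true; have /existsNP[n0 h0] := nob false.
have [x Wx] := unb (maxn n1 n0); rewrite geq_max => /andP[le1 le0].
by case dx : (digit1 x); [apply: h1|apply: h0]; exists x.
Qed.

(** * Passage to an infinite [W]-computable set *)

(* The range of an unbounded W-computable function need only be W-c.e.; the
   values that exceed all earlier ones form a W-computable subset. *)
Lemma infinite_computable_image (W : set nat) (P : pred nat) (g : nat -> nat) :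
  computable_in (char_fun W) (fun v : 1.-tuple nat => P (nth 0 v 0)) ->
  computable_in (char_fun W) (fun v : 1.-tuple nat => g (nth 0 v 0)) ->
  (forall n, exists x, [/\ W x, P x & n <= g x]) ->
  exists Y : set nat, [/\ infinite_set Y, turing_le Y W &
    forall a, Y a -> exists x, [/\ W x, P x & a = g x]].
Proof.
move=> cP cg unb.
pose h (w : 2.-tuple nat) := [&& nth 0 w 0 \in W, P (nth 0 w 0) &
  nth 0 w 1 <= g (nth 0 w 0)].
have hP (v : 1.-tuple nat) : exists y, h (cons_tuple y v).
  have [x [Wx Px lex]] := unb (nth 0 v 0).
  by exists x; rewrite /h /= Px lex mem_set.
pose m a := ex_minn (hP [tuple a]).
have mP a : [/\ W (m a), P (m a), a <= g (m a) &
    forall x, W x -> P x -> a <= g x -> m a <= x].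
  rewrite /m; case: ex_minnP => x /and3P[/= /set_mem Wx Px lex] minx.
  by split=> // y Wy Py ley; apply: minx; rewrite /h /= Py ley mem_set.
(* [m a] is the first eligible [x] with [g x] at least [a]; equality says that [a] is a record value
   of [g], which is decidable from [W]. *)
exists [set a | g (m a) = a]; split.
- apply/infinite_nat_unbounded => n; have [Wm Pm lem minm] := mP n.
  exists (g (m n)) => //=; congr g; apply/eqP; rewrite eqn_leq.
  (* The point [m n] itself reaches [g (m n)], and any point reaching this value also reaches [n];
     so both searches stop at [m n]. *)
  have [Wm' Pm' lem' ->] //= := mP (g (m n)).
  by apply: minm => //; apply: leq_trans lem'.
- have cgc n (k : n.-tuple nat -> nat) : computable_in (char_fun W) k ->
    computable_in (char_fun W) (fun v => g (k v)) by apply: computable_in_comp1.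
  have cPc n (k : n.-tuple nat -> nat) : computable_in (char_fun W) k ->
    computable_in (char_fun W) (fun v => P (k v)).
    exact: (@computable_in_comp1 _ _ (fun x => P x)).
  have cm : computable_in (char_fun W) (fun v : 1.-tuple nat => m (nth 0 v 0)).
    have : computable_in (char_fun W) (fun v => ex_minn (hP v)).
      apply/computable_in_min/computable_in_neg/computable_in_and.
        exact/computable_in_oracle/computable_in_nth.
      apply: computable_in_and; first exact/cPc/computable_in_nth.
      apply: computable_in_leq; first exact: computable_in_nth.
      exact/cgc/computable_in_nth.
    by congr computable_in; apply: funext => v; apply: eq_ex_minn.
  have := computable_in_eq (cgc _ _ cm) (computable_in_nth _ 1 0).
  congr computable_in; apply: funext => v; rewrite theadE /char_fun.
  by congr nat_of_bool; apply/eqP/idP => [/mem_set|/set_mem].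
- by move=> a /= <-; have [Wm Pm _ _] := mP a; exists (m a).
Qed.

Theorem theorem2p1 (A : set nat) (hA : Delta02 A) :
  exists c : nat -> 'I_2,
    computable (fun v : 1.-tuple nat => c (thead v) : nat) /\
    forall W : set nat,
      W `<=` posnat -> infinite_set W -> monochromatic c (FS_le 2 W) ->
      exists Y : set nat,
        [/\ infinite_set Y, turing_le Y W & Y `<=` A \/ Y `<=` ~` A].
Proof.
have [f cf limf] := Delta02_limit hA.
exists (fun n => if coloring f n then ord_max else ord0); split.
  have cid := computable_in_nth (fun=> 0) 1 0.
  have : computable (fun v : 1.-tuple nat => coloring f (nth 0 v 0)).
    apply: computable_in_addb; last exact: computable_in_digit1.
    apply: (computable_in_comp2 (F := fun a b => f a b)) => //.
    exact: computable_in_val3.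
  by congr computable_in; apply: funext => v; rewrite theadE; case: coloring.
move=> W Wpos Winf monoW.
have {}monoW : monochromatic (coloring f) (FS_le 2 W).
  by move=> x y /monoW h /h; case: coloring; case: coloring.
have unb := mono_val3_unbounded limf Wpos Winf monoW.
have [b unbb] := mono_digit unb.
have [x0 Wx0 _] := unb 0.
have [|||Y [Yinf YW Yim]] :=
    @infinite_computable_image W (fun x => digit1 x == b) val3.
- have cd : computable_in (char_fun W)
      (fun v : 1.-tuple nat => digit1 (nth 0 v 0)).
    exact/computable_in_digit1/computable_in_nth.
  have := computable_in_neg (computable_in_addb cd (computable_in_cst _ 1 b)).
  by congr computable_in; apply: funext => v; case: digit1; case: (b).
- exact/computable_in_val3/computable_in_nth.
- by move=> n; have [x [Wx dx lex]] := unbb n; exists x; split=> //; apply/eqP.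
exists Y; split=> //.
(* The right-hand side does not depend on [a]: by monochromaticity the color is that of [x0], and
   the digit on the chosen preimages is [b]. Membership in [A] is thus constant on [Y]. *)
have YA a : Y a -> `[<A a>] = coloring f x0 (+) b.
  move=> /Yim[x [Wx /eqP dx ->]].
  rewrite (monoW _ _ (FS_le2_self Wx0) (FS_le2_self Wx)).
  by rewrite (mono_color limf Wpos Winf monoW Wx) dx addbK.
case cb : (coloring f x0 (+) b) YA => YA; [left|right] => a /YA.
  by move/asboolP.
by move=> /asboolP.
Qed.
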